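(* Consider the procurement auction with potential participants $Z$ described in the context, in which the operator must procure at least $M$ MW and each participant's offers are multiples of $m$. Suppose that for each $j\in Z$ the following holds: whenever $a,b,c,d\in\{0,1,\dots,n_j\}$ satisfy $p_j^{(b)}-p_j^{(a)}=p_j^{(d)}-p_j^{(c)}>0$ and $0\le p_j^{(a)}<p_j^{(c)}$, then $$c_j^{(d)}-c_j^{(c)}>c_j^{(b)}-c_j^{(a)}.$$ Then, under the VCG payment rule, every participant satisfies payoff monotonicity: for every $j\in Z$ and all $S\subseteq S'\subseteq Z$ with $j\in S$ such that the problem defining $J^\star(S\setminus\{j\})$ is feasible, $$J^\star(S'\setminus\{j\})-J^\star(S')\ \le\ J^\star(S\setminus\{j\})-J^\star(S).$$
   Context: $Z$ is a finite set of potential participants. $M>0$ is the amount of power to be procured and $m>0$ is an increment dividing $M$ (i.e. $M/m$ is a positive integer). Each $j\in Z$ submits offers indexed by $k=1,\dots,n_j$: offer $k$ consists of the power amount $p_j^{(k)}=km$ and a requested cost $c_j^{(k)}\ge 0$. By convention $p_j^{(0)}=0$ and $c_j^{(0)}=0$ (nothing accepted). Write $p_j=(p_j^{(k)})_{k=1}^{n_j}$ and $c_j=(c_j^{(k)})_{k=1}^{n_j}$. For $S\subseteq Z$ the auction is cleared by $$J^\star(S)=\min_{x}\ \sum_{j\in S}c_j^\top x_j\quad\text{s.t.}\quad \sum_{j\in S}p_j^\top x_j\ge M,\quad \mathbf 1^\top x_j\le 1\ \ \forall j\in S,\quad x_j\in\{0,1\}^{n_j}\ \ \forall j\in S,$$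 so at most one offer of each participant is accepted. The quantity $J^\star(S\setminus\{j\})-J^\star(S)$ is the utility of a truthful participant $j\in S$ under the VCG payment rule (Clarke pivot) in the auction with participants $S$. (If the problem for $S\setminus\{j\}$ is feasible then so are those for $S$, $S'\setminus\{j\}$ and $S'$.) *)

(* Defs.v *)
From HB Require Import structures.
From mathcomp Require Import all_boot all_order all_algebra.

Set Implicit Arguments.
Unset Strict Implicit.
Unset Printing Implicit Defensive.

Import Order.TTheory GRing.Theory Num.Theory.
Local Open Scope ring_scope.

(* k ranges over 0, ..., n_j; index 0 is the "nothing accepted" option *)
Definition power (R : realFieldType) (Z : finType) (n : Z -> nat) (m : R)
    (j : Z) (k : 'I_(n j).+1) : R :=
  k%:R * m.

(* x j k says whether offer k.+1 of participant j is accepted; the actual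
   offers 1, ..., n_j are the indices lift ord0 k for k : 'I_(n j).  One type
   serves every set S of participants: the components x j with j \notin S occur
   neither in the constraints nor in the objective. *)
Definition allocation (Z : finType) (n : Z -> nat) : finType :=
  {dffun forall j : Z, {ffun 'I_(n j) -> bool}}.

Definition procured (R : realFieldType) (Z : finType) (n : Z -> nat) (m : R)
    (S : {set Z}) (x : allocation n) : R :=
  \sum_(j in S) \sum_(k < n j) power m (lift ord0 k) * (x j k)%:R.

Definition total_cost (R : realFieldType) (Z : finType) (n : Z -> nat)
    (c : forall j : Z, 'I_(n j).+1 -> R) (S : {set Z}) (x : allocation n) : R :=
  \sum_(j in S) \sum_(k < n j) c j (lift ord0 k) * (x j k)%:R.

Definition feasible_alloc (R : realFieldType) (Z : finType) (n : Z -> nat)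
    (M m : R) (S : {set Z}) (x : allocation n) : bool :=
  (M <= procured m S x) && [forall j in S, \sum_(k < n j) x j k <= 1]%N.

Definition feasible (R : realFieldType) (Z : finType) (n : Z -> nat)
    (M m : R) (S : {set Z}) : Prop :=
  exists x : allocation n, feasible_alloc M m S x.

(* The value 0 for an infeasible problem is a dummy. *)
Definition Jstar (R : realFieldType) (Z : finType) (n : Z -> nat) (M m : R)
    (c : forall j : Z, 'I_(n j).+1 -> R) (S : {set Z}) : R :=
  if [pick x : allocation n | feasible_alloc M m S x] is Some x0 then
    total_cost c S
      [arg min_(x < x0 | feasible_alloc M m S x) total_cost c S x]%O
  else 0.

Lemma JstarP (R : realFieldType) (Z : finType) (n : Z -> nat) (M m : R)
    (c : forall j : Z, 'I_(n j).+1 -> R) (S : {set Z}) :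
  feasible n M m S ->
  (exists2 x : allocation n,
     feasible_alloc M m S x & total_cost c S x = Jstar M m c S) /\
  (forall x : allocation n,
     feasible_alloc M m S x -> Jstar M m c S <= total_cost c S x).
Proof.
move=> [y fy]; rewrite /Jstar; case: pickP => [x0 fx0|/(_ y)]; last by rewrite fy.
case: arg_minP => // x fx xmin; split; first by exists x.
by move=> z /xmin.
Qed.

(* Main.v *)
(* By convexity, if an optimal solution x for S \ j and an optimal solution y for
   S' are recombined into u for S' \ j and v for S with u_i + v_i = x_i + y_i
   and u_i between x_i and y_i, then the total cost does not increase.  Outside
   S \ j both u and v copy y; inside, u is obtained by moving y towards x one
   unit at a time until u procures M, which leaves enough power for v. *)

Require Import Defs.
From HB Require Import structures.
From mathcomp Require Import all_boot all_order all_algebra.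
From mathcomp Require Import zify lra.
Set Implicit Arguments.
Unset Strict Implicit.
Unset Printing Implicit Defensive.
Import Order.TTheory GRing.Theory Num.Theory.
Local Open Scope ring_scope.

(** Reads a 0/1 row with at most one accepted offer as a quantity in units of [m]; the empty row
    gives 0. *)
Definition accepted (n : nat) (f : {ffun 'I_n -> bool}) : 'I_n.+1 :=
  if [pick k | f k] is Some k then lift ord0 k else ord0.

Lemma sum_accepted (R : pzRingType) (n : nat) (f : {ffun 'I_n -> bool})
    (F : 'I_n.+1 -> R) :
  (\sum_(k < n) f k <= 1)%N -> F ord0 = 0 ->
  \sum_(k < n) F (lift ord0 k) * (f k)%:R = F (accepted f).
Proof.
move=> f_le1 F0; rewrite /accepted; case: pickP => [k fk|f0]; last first.
  by rewrite F0 big1 // => k _; rewrite f0 mulr0.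
move: f_le1; rewrite (bigD1 k) //= fk ltnS leqn0 sum_nat_eq0 => /forallP f0.
rewrite (bigD1 k) //= fk mulr1 big1 ?addr0 // => i ik.
by move: (f0 i); rewrite ik /= eqb0 => /negbTE ->; rewrite mulr0.
Qed.

(** Right inverse of [accepted]: [ord0] is never a [lift ord0 k], so quantity 0 becomes the
    all-false row. *)
Definition allocation_of (Z : finType) (n : Z -> nat)
    (q : forall j : Z, 'I_(n j).+1) : allocation n :=
  [ffun j => [ffun k => lift ord0 k == q j]].

Lemma allocation_of_le1 (Z : finType) (n : Z -> nat)
    (q : forall j : Z, 'I_(n j).+1) (j : Z) :
  (\sum_(k < n j) allocation_of q j k <= 1)%N.
Proof.
rewrite ffunE; under eq_bigr do rewrite ffunE.
case: (unliftP ord0 (q j)) => [k0 ->|->]; last by rewrite big1.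
by rewrite (bigD1 k0) //= eqxx big1 // => i ik; rewrite (inj_eq lift_inj) (negbTE ik).
Qed.

Lemma accepted_allocation_of (Z : finType) (n : Z -> nat)
    (q : forall j : Z, 'I_(n j).+1) (j : Z) :
  accepted (allocation_of q j) = q j.
Proof.
rewrite /accepted ffunE; case: pickP => [k|q0]; first by rewrite ffunE => /eqP.
by case: (unliftP ord0 (q j)) => // k Ek; move: (q0 k); rewrite ffunE Ek eqxx.
Qed.

Section Quantities.
Variables (R : realFieldType) (Z : finType) (n : Z -> nat) (M m : R) (K : nat).
Variable c : forall j : Z, 'I_(n j).+1 -> R.
Arguments c : clear implicits.
Hypotheses (m_gt0 : 0 < m) (MK : M / m = K%:R) (c_0 : forall j, c j ord0 = 0).
Implicit Types (S : {set Z}) (x : allocation n) (q : forall j : Z, 'I_(n j).+1).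

(** Dividing by [m > 0] makes the demand an integer count of units. Clearing thus amounts to
    choosing one quantity per participant, with total at least [K], at least cost. *)
Lemma procured_accepted S x :
  (forall j, j \in S -> (\sum_(k < n j) x j k <= 1)%N) ->
  (M <= procured m S x) = (K <= \sum_(j in S) accepted (x j))%N.
Proof.
move=> x_le1; have -> : procured m S x = (\sum_(j in S) accepted (x j))%:R * m.
  rewrite natr_sum mulr_suml; apply: eq_bigr => j jS.
  by rewrite sum_accepted ?x_le1 // /power mul0r.
by rewrite -ler_pdivrMr // MK ler_nat.
Qed.

Lemma total_cost_accepted S x :
  (forall j, j \in S -> (\sum_(k < n j) x j k <= 1)%N) ->
  total_cost c S x = \sum_(j in S) c j (accepted (x j)).
Proof. by move=> x_le1; apply: eq_bigr => j jS; rewrite sum_accepted ?x_le1. Qed.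

Lemma feasible_quantity S q :
  (K <= \sum_(j in S) q j)%N -> feasible_alloc M m S (allocation_of q).
Proof.
move=> Kq; apply/andP; split; last first.
  by apply/forall_inP => j _; exact: allocation_of_le1.
rewrite procured_accepted => [|j _]; last exact: allocation_of_le1.
by under eq_bigr do rewrite accepted_allocation_of.
Qed.

Lemma Jstar_le S q :
  (K <= \sum_(j in S) q j)%N -> Jstar M m c S <= \sum_(j in S) c j (q j).
Proof.
move=> /feasible_quantity fq; have [_ /(_ _ fq)] := JstarP c (ex_intro (fun x => feasible_alloc M m S x) _ fq).
rewrite total_cost_accepted => [|j _]; last exact: allocation_of_le1.
by under eq_bigr do rewrite accepted_allocation_of.
Qed.

Lemma Jstar_attained S : feasible n M m S ->
  exists2 q : forall j : Z, 'I_(n j).+1,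
    (K <= \sum_(j in S) q j)%N & \sum_(j in S) c j (q j) = Jstar M m c S.
Proof.
move=> /(JstarP c) [[x /andP[Mx /forall_inP x_le1] <-] _].
exists (fun j => accepted (x j)); last by rewrite total_cost_accepted.
by rewrite -procured_accepted.
Qed.

Lemma feasible_subset S S' :
  S \subset S' -> feasible n M m S -> feasible n M m S'.
Proof.
move=> sSS' /Jstar_attained[q Kq _]; exists (allocation_of q).
apply: feasible_quantity; apply: leq_trans Kq _.
by rewrite [leqRHS](big_setID S) /= (setIidPr sSS') leq_addr.
Qed.

End Quantities.

(** Discrete intermediate values: as long as the sum of [u] is below that of [x], some [u i < x i],
    and raising that entry by one keeps it between [x i] and [y i]. *)
Lemma interpolate_sum (I : finType) (A : {set I}) (x y : I -> nat) (t : nat) :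
  (\sum_(i in A) y i <= t <= \sum_(i in A) x i)%N ->
  exists2 u : I -> nat,
    forall i, (minn (x i) (y i) <= u i <= maxn (x i) (y i))%N &
    (\sum_(i in A) u i = t)%N.
Proof.
elim: t => [|t IHt] /andP[yt tx].
  by exists y => [i|]; [rewrite geq_minr leq_maxr | apply/eqP; rewrite -leqn0].
move: yt; rewrite leq_eqVlt => /predU1P[<-|yt].
  by exists y => // i; rewrite geq_minr leq_maxr.
have [|u uP ut] := IHt; first by rewrite -ltnS yt ltnW.
have [/existsP[i /andP[iA ui]]|/existsPn u_ge] :=
  boolP [exists i, (i \in A) && (u i < x i)%N]; last first.
  move: tx; rewrite -ut ltnNge leq_sum // => i iA.
  by move: (u_ge i); rewrite iA -leqNgt.
exists (fun k => u k + (k == i))%N => [k|].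
  by move: (uP k); case: eqP => [->|_]; lia.
by rewrite big_split /= ut (bigD1 i) //= eqxx big1 ?addn0 ?addn1 // => k /andP[_ /negbTE ->].
Qed.

(** Increasing marginal costs are discrete convexity, so moving a pair inward with its sum fixed
    cannot raise the cost. If [u] is an endpoint then [v] is the other one and equality holds; the
    strict hypothesis covers the interior case. *)
Lemma convex_exchange (R : realFieldType) (n : nat) (m : R) (c : 'I_n.+1 -> R)
    (x y u v : 'I_n.+1) :
  0 < m ->
  (forall a b c' d : 'I_n.+1,
     b%:R * m - a%:R * m = d%:R * m - c'%:R * m -> 0 < b%:R * m - a%:R * m ->
     0 <= a%:R * m -> a%:R * m < c'%:R * m -> c b - c a < c d - c c') ->
  (minn x y <= u <= maxn x y)%N -> (u + v = x + y)%N ->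
  c u + c v <= c x + c y.
Proof.
move=> m_gt0 c_marginal.
wlog xy : x y / (x <= y)%N => [hwlog|].
  case/orP: (leq_total x y) => [/hwlog //|/hwlog].
  by rewrite minnC maxnC (addnC y) (addrC (c y)).
rewrite (minn_idPl xy) (maxn_idPr xy) => /andP[xu uy] uv.
move: xu; rewrite leq_eqVlt => /predU1P[/val_inj xu|xu].
  have -> : v = y by apply: val_inj => /=; move: uv; rewrite xu; lia.
  by rewrite xu.
move: uy; rewrite leq_eqVlt => /predU1P[/val_inj uy|uy].
  have -> : v = x by apply: val_inj => /=; move: uv; rewrite uy; lia.
  by rewrite uy addrC.
suff: c u - c x < c y - c v by lra.
have uvR : u%:R + v%:R = x%:R + y%:R :> R by rewrite -!natrD uv.
(* The steps from [x] to [u] and from [v] to [y] have equal length, and [x < v] because [u < y]. *)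
apply: c_marginal.
- by rewrite -!mulrBl; congr (_ * _); lra.
- by rewrite -mulrBl mulr_gt0 // subr_gt0 ltr_nat.
- by rewrite mulr_ge0 // ltW.
- by rewrite ltr_pM2r // ltr_nat; lia.
Qed.

Theorem theorem3 (R : realFieldType) (Z : finType) (M m : R) (n : Z -> nat)
    (c : forall j : Z, 'I_(n j).+1 -> R)
    (M_gt0 : 0 < M) (m_gt0 : 0 < m)
    (m_dvd_M : exists2 K : nat, (0 < K)%N & M / m = K%:R)
    (c_ge0 : forall (j : Z) (k : 'I_(n j).+1), 0 <= c j k)
    (c_0 : forall j : Z, c j ord0 = 0)
    (c_marginal : forall (j : Z) (a b c' d : 'I_(n j).+1),
        power m b - power m a = power m d - power m c' ->
        0 < power m b - power m a ->
        0 <= power m a -> power m a < power m c' ->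
        c j b - c j a < c j d - c j c') :
  forall (j : Z) (S S' : {set Z}),
    S \subset S' -> j \in S -> feasible n M m (S :\ j) ->
    Jstar M m c (S' :\ j) - Jstar M m c S'
      <= Jstar M m c (S :\ j) - Jstar M m c S.
Proof.
move=> j S S' sSS' jS feasSj.
have [K _ MK] := m_dvd_M.
have jS' : j \in S' by exact: (subsetP sSS').
have feasS' : feasible n M m S'.
  have sSj := subset_trans (subsetDl S [set j]) sSS'.
  exact: (feasible_subset m_gt0 MK c_0 sSj feasSj).
(* The values at [S :\ j] and [S'] become costs of optimal quantities; the other two values only
   need upper bounds. *)
have [x Kx <-] := Jstar_attained m_gt0 MK c_0 feasSj.
have [y Ky <-] := Jstar_attained m_gt0 MK c_0 feasS'.
(* [S' :\ j] is the disjoint union of [A] and [B]; the split serves both quantities in [nat] and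
   costs in [R]. *)
set A := S :\ j in Kx *; set B := S' :\: S.
have splitS' (V : Type) (idx : V) (op : Monoid.com_law idx) (F : Z -> V) :
    \big[op/idx]_(i in S' :\ j) F i
    = op (\big[op/idx]_(i in A) F i) (\big[op/idx]_(i in B) F i).
  rewrite (big_setID A) /=; congr (op _ _); apply: eq_bigl => i; rewrite !inE.
    by case: (boolP (i \in S)) => [/(subsetP sSS') ->|]; rewrite ?andbF ?andbT ?andbb.
  by case: (eqVneq i j) => [->|]; rewrite ?jS ?andbF //= andbC.
(* The last inequality is the demand met by [x + y - u] on [A] together with [y j], written without
   truncated subtraction. *)
have [u0 u0P [Ku0 Kv0]] : exists2 u : Z -> nat,
    forall i, (minn (x i) (y i) <= u i <= maxn (x i) (y i))%N &
    (K <= \sum_(i in A) u i + \sum_(i in B) y i)%N /\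
    (\sum_(i in A) u i + K <= \sum_(i in A) x i + \sum_(i in A) y i + y j)%N.
  move: Ky; rewrite (big_setD1 j) //= splitS' /= => Ky.
  (* If [y] meets the demand without [j], keep [u = y]; then [v = x] on [A], which already procures
     [K]. *)
  have [Kle|Kgt] := leqP K (\sum_(i in A) y i + \sum_(i in B) y i)%N.
    exists (fun i => y i) => [i|]; first by rewrite geq_minr leq_maxr.
    by split=> //; lia.
  (* Otherwise [A] must supply exactly what [B] leaves open: [y] falls short of this target on [A],
     while [x] reaches it. *)
  have [|u uP ut] := @interpolate_sum _ A x y (K - \sum_(i in B) y i)%N.
    by apply/andP; split; lia.
  by exists u => //; rewrite ut; split; lia.
(* Both values lie between [x i] and [y i], hence are at most [n i], so [inord] does not fall back
   to its default. *)
pose u i : 'I_(n i).+1 := if i \in A then inord (u0 i) else y i.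
pose v i : 'I_(n i).+1 := if i \in A then inord (x i + y i - u0 i) else y i.
have uA i : i \in A -> u i = u0 i :> nat.
  move=> iA; rewrite /u iA inordK //.
  by move: (u0P i) (ltn_ord (x i)) (ltn_ord (y i)); lia.
have vA i : i \in A -> (u i + v i = x i + y i)%N.
  move=> iA; rewrite (uA _ iA) /v iA inordK //;
  by move: (u0P i) (ltn_ord (x i)) (ltn_ord (y i)); lia.
have uB i : i \in B -> u i = y i.
  by rewrite /u !inE => /andP[/negbTE ->]; rewrite andbF.
have vj : v j = y j by rewrite /v !inE eqxx.
have uvA : (\sum_(i in A) u i + \sum_(i in A) v i
            = \sum_(i in A) x i + \sum_(i in A) y i)%N.
  by rewrite -!big_split; apply: eq_bigr => i; exact: vA.
have suA : (\sum_(i in A) u i = \sum_(i in A) u0 i)%N by exact: eq_bigr.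
have Ju : Jstar M m c (S' :\ j) <= \sum_(i in S' :\ j) c i (u i).
  apply: Jstar_le m_gt0 MK c_0 _ _ _; rewrite splitS' /= suA.
  by under [X in (_ + X)%N]eq_bigr => i iB do rewrite uB //.
have Jv : Jstar M m c S <= \sum_(i in S) c i (v i).
  by apply: Jstar_le m_gt0 MK c_0 _ _ _; rewrite (big_setD1 j) //= vj -/A; lia.
have cost_uv : \sum_(i in A) c i (u i) + \sum_(i in A) c i (v i)
               <= \sum_(i in A) c i (x i) + \sum_(i in A) c i (y i).
  rewrite -!big_split; apply: ler_sum => i iA.
  apply: (convex_exchange m_gt0 (c_marginal i)); last exact: vA.
  by rewrite uA.
(* The costs of [y] on [B] and at [j] cancel, leaving the exchange inequality [cost_uv] on [A]. *)
move: Ju Jv; rewrite splitS' (big_setD1 j jS) (big_setD1 j jS') /= splitS' vj -/A /=.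
by under [X in _ <= _ + X -> _]eq_bigr => i iB do rewrite uB //; lra.
Qed.
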